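(* Let $N\ge3$ be an odd integer. The $SL_2\mathbb{C}$-character variety of the free group on two generators is $\mathbb{C}^3$. If $\phi:\chi(\Sigma_{0,3})\to\mathbb{C}$ is a place such that none of $\phi(T_N(x))$, $\phi(T_N(y))$, $\phi(T_N(z))$ is equal to $2$ or $-2$, then the specialization at $\phi$ of the pairing $\sigma$ is nondegenerate and $K_N(\Sigma_{0,3})_\phi$ is a Frobenius algebra over $\mathbb{C}$.
   Context: Let $A=e^{\pi i/N}$. The Tchebychev polynomials are $T_0(x)=2$, $T_1(x)=x$, $T_{n+1}(x)=xT_n(x)-T_{n-1}(x)$. $\Sigma_{0,3}$ is the compact oriented planar surface with three boundary components (pair of pants); $\pi_1(\Sigma_{0,3})$ is free on two generators. Its Kauffman bracket skein algebra $K_N(\Sigma_{0,3})$ (framed links in $\Sigma_{0,3}\times[0,1]$ modulo the Kauffman bracket skein relations with parameter $A$, with stacking product) is isomorphic to $\mathbb{C}[x,y,z]$, where $x,y,z$ are blackboard framed curves parallel to the three boundary components. The subalgebra $\chi(\Sigma_{0,3})$ is the image of the threading map (threading every component of a framed link with $T_N$); it is the span of $\{T_{Na}(x)T_{Nb}(y)T_{Nc}(z): a,b,c\ge0\}$, i.e. a polynomial ring in the three variables $T_N(x),T_N(y),T_N(z)$, and is isomorphic to the coordinate ring of the $SL_2\mathbb{C}$-character variety of $\pi_1(\Sigma_{0,3})$. $K_N(\Sigma_{0,3})$ is a free $\chi(\Sigma_{0,3})$-module of rank $N^3$ with basis $T_j(x)T_k(y)T_l(z)$, $0\le j,k,l\le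 N-1$. $Tr:K_N(\Sigma_{0,3})\to\chi(\Sigma_{0,3})$ is $\frac{1}{N^3}$ times the trace of left multiplication, and $\sigma(\alpha\otimes\beta)=Tr(\alpha\beta)$. A place is a ring homomorphism ($\mathbb{C}$-algebra homomorphism) $\phi:\chi(\Sigma_{0,3})\to\mathbb{C}$. The specialization is $K_N(\Sigma_{0,3})_\phi=K_N(\Sigma_{0,3})/I_\phi$ with $I_\phi=(\ker\phi)K_N(\Sigma_{0,3})$; the specialization of $\sigma$ is the induced bilinear form on $K_N(\Sigma_{0,3})_\phi$ with values in $\mathbb{C}$, given by $(\alpha,\beta)\mapsto Tr_\phi(\alpha\beta)$, where $Tr_\phi$ is the trace of left multiplication on $K_N(\Sigma_{0,3})_\phi$ normalized so that $Tr_\phi(1)=1$. The Frobenius algebra structure is with respect to the functional $Tr_\phi$. A Frobenius algebra over a field $k$ is a finite dimensional $k$-algebra $B$ equipped with a $k$-linear functional $\epsilon:B\to k$ having no nontrivial principal ideals in its kernel; equivalently, for every $a\ne0$ in $B$ there is $b\in B$ with $\epsilon(ab)\neq0$. *)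

(* Defs.v *)
From HB Require Import structures.
From mathcomp Require Import all_boot all_order all_algebra.
From mathcomp Require Import mpoly complex boolp classical_sets functions reals.
Set Implicit Arguments.
Unset Strict Implicit.
Unset Printing Implicit Defensive.

Import Order.TTheory GRing.Theory Num.Theory.

Local Open Scope ring_scope.
Local Open Scope complex_scope.
Local Open Scope quotient_scope.

Section Traces.
(* [act] is the action of the scalars [A] on [V].  It is an explicit argument
   because a skein algebra is used both as a vector space over the complex
   numbers and as a module over its subalgebra [chi]. *)
Variables (A : comNzRingType) (V : zmodType) (act : A -> V -> V).

Definition is_basis n (e : 'I_n -> V) : Prop :=
  forall v : V, exists! c : 'rV[A]_n, v = \sum_(i < n) act (c 0 i) (e i).

Definition is_trace (f : V -> V) (t : A) : Prop :=
  exists n (e : 'I_n -> V) (M : 'M[A]_n),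
    [/\ is_basis e,
        forall j, f (e j) = \sum_(i < n) act (M i j) (e i)
      & t = \tr M].

(* The junk value 0 is taken only if [V] has no finite basis or [f] is not
   linear; for linear [f] the trace does not depend on the basis. *)
Definition mod_trace (f : V -> V) : A := xget 0 [set t | is_trace f t].

End Traces.

Section Forms.
Variables (k : fieldType) (B : algType k).

Definition nondegenerate_form (s : B -> B -> k) : Prop :=
  (forall a, (forall b, s a b = 0) -> a = 0) /\
  (forall b, (forall a, s a b = 0) -> b = 0).

Definition finite_dimensional : Prop :=
  exists n (e : 'I_n -> B), is_basis ( *:%R : k -> B -> B) e.

Definition frobenius_algebra (eps : B -> k) : Prop :=
  [/\ finite_dimensional,
      scalar eps
    & forall a : B, (forall b : B, eps (a * b) = 0) -> a = 0].

End Forms.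

Fixpoint tcheb (A : pzRingType) (n : nat) (x : A) : A :=
  match n with
  | 0 => 2
  | S m => match m with
           | 0 => x
           | S k => x * tcheb m x - tcheb k x
           end
  end.

(* The Kauffman bracket skein algebra of the pair of pants, under its standard
   identification with the polynomial ring on the three boundary curves: the
   monomial 'X_0 ^+ a * 'X_1 ^+ b * 'X_2 ^+ c is the multicurve made of a, b
   and c parallel blackboard framed copies of the boundary curves x, y, z. *)
Notation skein R := {mpoly R[i][3]}.

(* Threading each component of that multicurve with T_N. *)
Definition threading (R : realType) (N : nat) (p : skein R) : skein R :=
  p \mPo [tuple tcheb N ('X_i : skein R) | i < 3].

Definition in_chi (R : realType) (N : nat) : {pred skein R} :=
  fun a => `[< exists p, a = threading N p >].

Section Chi.
Variables (R : realType) (N : nat).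

Lemma in_chi_subalg_closed : subalg_closed (@in_chi R N).
Proof.
split.
- by apply/asboolP; exists 1; rewrite /threading rmorph1.
- move=> c _ _ /asboolP[p ->] /asboolP[q ->]; apply/asboolP; exists (c *: p + q).
  by rewrite /threading linearP.
- move=> _ _ /asboolP[p ->] /asboolP[q ->]; apply/asboolP; exists (p * q).
  by rewrite /threading rmorphM.
Qed.

HB.instance Definition _ :=
  GRing.isSubalgClosed.Build R[i] (skein R) (@in_chi R N) in_chi_subalg_closed.

Record chi : Type := Chi { chi_val :> skein R; _ : chi_val \in @in_chi R N }.

HB.instance Definition _ := [isSub for chi_val].
HB.instance Definition _ := [Choice of chi by <:].
HB.instance Definition _ := [SubChoice_isSubComNzRing of chi by <:].
HB.instance Definition _ := [SubZmodule_isSubLmodule of chi by <:].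
HB.instance Definition _ := [SubNzRing_SubLmodule_isSubLalgebra of chi by <:].
HB.instance Definition _ := [SubLalgebra_isSubAlgebra of chi by <:].

Lemma tcheb_in_chi (i : 'I_3) : tcheb N ('X_i : skein R) \in @in_chi R N.
Proof.
by apply/asboolP; exists 'X_i; rewrite /threading comp_mpolyXU -tnth_nth tnth_mktuple.
Qed.

(* T_N(x), T_N(y), T_N(z) for i = 0, 1, 2. *)
Definition chi_gen (i : 'I_3) : chi := Chi (tcheb_in_chi i).

End Chi.

Definition chi_act (R : realType) (N : nat) (a : chi R N) (v : skein R) : skein R :=
  chi_val a * v.

Definition Tr (R : realType) (N : nat) (a : skein R) : chi R N :=
  ((N ^ 3)%:R^-1 : R[i]) *: mod_trace (@chi_act R N) ( *%R a).

Definition sigma (R : realType) (N : nat) (a b : skein R) : chi R N :=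
  Tr N (a * b).

Notation place R N := ({lrmorphism chi R N -> R[i] | *%R}).

Section Specialization.
Variables (R : realType) (N : nat) (phi : place R N).

Definition place_ideal : {pred skein R} := fun p =>
  `[< exists2 s : seq (chi R N * skein R), (forall u, u \in s -> phi u.1 = 0)
      & p = \sum_(u <- s) chi_val u.1 * u.2 >].

Lemma tcheb_morph (A B : pzRingType) (f : {rmorphism A -> B}) n x :
  f (tcheb n x) = tcheb n (f x).
Proof.
elim/ltn_ind: n => -[|[|n]] IH //=; first by rewrite rmorph_nat.
by rewrite rmorphB rmorphM -!/(tcheb _.+1 _) !IH.
Qed.

Lemma size_tcheb (F : fieldType) n : size (tcheb n.+1 ('X : {poly F})) = n.+2.
Proof.
elim/ltn_ind: n => -[|[|n]] IH; first by rewrite size_polyX.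
  rewrite /= size_polyDl; first by rewrite size_mulX ?polyX_eq0 // size_polyX.
  by rewrite size_mulX ?polyX_eq0 // size_polyX size_polyN -polyC_natr (leq_ltn_trans (size_polyC_leq1 _)).
have -> : tcheb n.+3 'X = 'X * tcheb n.+2 'X - tcheb n.+1 'X :> {poly F} by [].
have n0 : tcheb n.+2 'X != 0 :> {poly F} by rewrite -size_poly_gt0 IH.
rewrite size_polyDl; first by rewrite mulrC size_mulX // IH.
by rewrite mulrC size_mulX // size_polyN !IH.
Qed.

Lemma tcheb_surj (u : R[i]) : (0 < N)%N -> exists z, tcheb N z = u.
Proof.
case: N => // n _.
have sz : size (tcheb n.+1 'X - u%:P) = n.+2.
  by rewrite size_polyDl size_tcheb // size_polyN (leq_ltn_trans (size_polyC_leq1 u)).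
have /closed_rootP[z /rootP] : size (tcheb n.+1 'X - u%:P) != 1%N by rewrite sz.
rewrite hornerD hornerN hornerC => /eqP; rewrite subr_eq0 => /eqP <-.
exists z; rewrite -[in LHS](hornerX z); symmetry.
exact: (tcheb_morph (horner_eval z) n.+1 'X).
Qed.

Lemma place_point : exists v : 'I_3 -> R[i], forall a : chi R N, phi a = (chi_val a).@[v].
Proof.
have /choice[v hv] : forall i, exists z, tcheb N z = phi (chi_gen R N i).
  move=> i; case: (posnP N) => [N0|]; last exact: tcheb_surj.
  have -> : chi_gen R N i = 2%:R by apply: val_inj; rewrite /= N0.
  by exists 0; rewrite rmorph_nat N0.
exists v => -[a]; move=> /[dup] /asboolP[p ep] ina.
have e : Chi ina = \sum_(m <- msupp p) p@_m *: \prod_(i < 3) chi_gen R N i ^+ m i.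
  apply: val_inj; rewrite raddf_sum [LHS]ep /threading comp_mpolyE.
  apply: eq_bigr => m _; rewrite [RHS]GRing.valZ rmorph_prod; congr (_ *: _).
  by apply: eq_bigr => i _; rewrite rmorphXn tnth_mktuple.
rewrite [in LHS]e [chi_val _]ep comp_mpoly_meval [in RHS]mevalE raddf_sum /=.
apply: eq_bigr => m _; rewrite linearZ rmorph_prod /=; congr (_ * _).
apply: eq_bigr => i _; rewrite rmorphXn /= -hv tnth_mktuple.
by rewrite (tcheb_morph (meval v)) /= mevalXU.
Qed.

Lemma place_ideal_closed : idealr_closed place_ideal.
Proof.
split.
- by apply/asboolP; exists [::]; rewrite // big_nil.
- have [v hv] := place_point; apply/asboolP => -[s s0 /(congr1 (meval v))/eqP].
  rewrite meval1 raddf_sum /= big_seq big1 ?oner_eq0 // => u us.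
  by rewrite mevalM -hv s0 // mul0r.
- move=> a _ _ /asboolP[s s0 ->] /asboolP[t t0 ->]; apply/asboolP.
  exists ([seq (u.1, a * u.2) | u <- s] ++ t).
    by move=> u; rewrite mem_cat => /orP[/mapP[w ws ->]|]; [exact: (s0 w)|exact: t0].
  rewrite big_cat big_map mulr_sumr; congr (_ + _).
  by apply: eq_bigr => u _; rewrite mulrCA.
Qed.

HB.instance Definition _ :=
  isIdealr.Build (skein R) place_ideal place_ideal_closed.

Definition spec : Type := {ideal_quot place_ideal}.
HB.instance Definition _ := GRing.ComNzRing.on spec.

Definition spec_pi (a : skein R) : spec := \pi_{ideal_quot place_ideal} a.

Lemma spec_pi_zmod : zmod_morphism spec_pi.
Proof. by move=> a b; rewrite /spec_pi rmorphB. Qed.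
Lemma spec_pi_monoid : monoid_morphism spec_pi.
Proof. by split=> [|a b]; rewrite /spec_pi ?rmorph1 ?rmorphM. Qed.
HB.instance Definition _ :=
  GRing.isZmodMorphism.Build (skein R) spec spec_pi spec_pi_zmod.
HB.instance Definition _ :=
  GRing.isMonoidMorphism.Build (skein R) spec spec_pi spec_pi_monoid.

Definition spec_scale (c : R[i]) (u : spec) : spec := spec_pi c%:MP * u.

Lemma spec_scaleA c d u : spec_scale c (spec_scale d u) = spec_scale (c * d) u.
Proof. by rewrite /spec_scale mpolyCM rmorphM mulrA. Qed.
Lemma spec_scale1 : left_id 1 spec_scale.
Proof. by move=> u; rewrite /spec_scale mpolyC1 rmorph1 mul1r. Qed.
Lemma spec_scaleDr : right_distributive spec_scale +%R.
Proof. by move=> c u v; rewrite /spec_scale mulrDr. Qed.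
Lemma spec_scaleDl u : {morph spec_scale^~ u : c d / c + d}.
Proof. by move=> c d; rewrite /spec_scale mpolyCD rmorphD mulrDl. Qed.
HB.instance Definition _ := GRing.Zmodule_isLmodule.Build R[i] spec
  spec_scaleA spec_scale1 spec_scaleDr spec_scaleDl.
Lemma spec_scaleAl (c : R[i]) (u v : spec) : c *: (u * v) = c *: u * v.
Proof. exact: mulrA. Qed.
HB.instance Definition _ :=
  GRing.Lmodule_isLalgebra.Build R[i] spec spec_scaleAl.
HB.instance Definition _ := GRing.Lalgebra_isComAlgebra.Build R[i] spec.

Definition spec_trace (b : spec) : R[i] :=
  mod_trace ( *:%R : R[i] -> spec -> spec) ( *%R b).

Definition Tr_spec (b : spec) : R[i] := spec_trace b / spec_trace 1.

(* [s] is the form induced by sigma on the quotient [spec]; it is unique since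
   [spec_pi] is surjective. *)
Definition specializes_sigma (s : spec -> spec -> R[i]) : Prop :=
  forall a b : skein R, s (spec_pi a) (spec_pi b) = phi (sigma N a b).

End Specialization.

Definition group_hom (G H : groupType) (f : G -> H) : Prop :=
  forall g h, f (g * h)%g = (f g * f h)%g.

Definition free_on_two (G : groupType) (a b : G) : Prop :=
  forall (H : groupType) (u v : H),
    (exists f : G -> H, [/\ group_hom f, f a = u & f b = v]) /\
    (forall f f' : G -> H, group_hom f -> group_hom f' ->
       f a = f' a -> f b = f' b -> f =1 f').

Section Characters.
Variables (R : realType) (G : groupType).

Definition SL2_rep (rho : G -> 'M[R[i]]_2) : Prop :=
  [/\ forall g, \det (rho g) = 1,
      rho 1%g = 1%:M
    & forall g h, rho (g * h)%g = rho g *m rho h].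

Definition character_variety : set (G -> R[i]) :=
  [set c | exists2 rho, SL2_rep rho & c = (fun g => \tr (rho g))].

(* The coordinate ring of the character variety: the algebra of functions on it
   generated by the evaluations c |-> c g, for g in G. *)
Definition regular_function (f : (G -> R[i]) -> R[i]) : Prop :=
  exists n (g : 'I_n -> G) (p : {mpoly R[i][n]}),
    forall c, character_variety c -> f c = p.@[fun i => c (g i)].

(* Isomorphism of affine varieties with affine d-space: a bijection on points
   that matches the regular functions with the polynomial functions. *)
Definition character_variety_is_affine_space (d : nat) : Prop :=
  exists Phi : (G -> R[i]) -> ('I_d -> R[i]),
    set_bij character_variety setT Phi /\
    forall f, regular_function f <->
      exists p : {mpoly R[i][d]},
        forall c, character_variety c -> f c = p.@[Phi c].

End Characters.

(* Main.v *)
Require Import Defs.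
From HB Require Import structures.
From mathcomp Require Import all_boot all_order all_algebra.
From mathcomp Require Import mpoly complex boolp classical_sets functions reals.
From mathcomp Require Import separable ring.
Set Implicit Arguments.
Unset Strict Implicit.
Unset Printing Implicit Defensive.
Import Order.TTheory GRing.Theory Num.Theory.
Local Open Scope ring_scope.
Local Open Scope complex_scope.
Local Open Scope quotient_scope.

(** Fricke coordinates: by Cayley-Hamilton, for A and B in SL_2 the span of
    1, A, B, AB over the polynomials in tr A, tr B, tr AB is closed under
    products and inverses, so every trace function on the free group is a
    polynomial in these three traces; explicit matrices realize all triples.

    Skein algebra: comparing leading monomials, the monomials with exponents
    < N form a basis of K_N over chi, and this basis descends to the
    specialization, so the trace commutes with specialization.  From
    T_N' = N U_N and T_N^2 = 4 + (x^2 - 4) U_N^2, the polynomial T_N - u has N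
    distinct roots when u <> 2, -2.  The Lagrange idempotents at the N^3 common
    roots of the ideal I_phi then form another basis of the specialization, on
    which multiplication by a is diagonal with entries a(p); hence Tr_phi is the
    average of the values at these points, and it pairs a with the idempotent
    at p to a(p) / N^3. *)

(** * Trace coordinates on the representations of a free group *)

(** The closure conditions make [P] a subgroup containing [a] and [b]. Freeness gives a homomorphism
    from [G] into it that fixes both generators; followed by the inclusion it is an endomorphism of
    [G], equal to the identity by uniqueness. *)
Lemma free_on_two_ind (G : groupType) (a b : G) (P : pred G) :
  free_on_two a b -> P 1%g -> (forall g h, P g -> P h -> P (g * h)%g) ->
  (forall g, P g -> P g^-1%g) -> P a -> P b -> forall g, P g.
Proof.
move=> Gfree P1 PM PV Pa Pb.
pose T := {g | P g}.
pose one : T := exist (fun g => P g) 1%g P1.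
pose mul (u v : T) : T :=
  exist (fun g => P g) (val u * val v)%g (PM _ _ (valP u) (valP v)).
pose inv (u : T) : T := exist (fun g => P g) (val u)^-1%g (PV _ (valP u)).
have mulA : associative mul by move=> u v w; apply: val_inj; exact: mulgA.
have mul1 : left_id one mul by move=> u; apply: val_inj; exact: mul1g.
have mulr1 : right_id one mul by move=> u; apply: val_inj; exact: mulg1.
have mulV : left_inverse one inv mul by move=> u; apply: val_inj; exact: mulVg.
have mulrV : right_inverse one inv mul.
  by move=> u; apply: val_inj; exact: mulgV.
pose H : groupType := HB.pack T (isGroup.Build T mulA mul1 mulr1 mulV mulrV).
have [[f [fM fa fb]] _] :=
  Gfree H (exist (fun g => P g) a Pa) (exist (fun g => P g) b Pb).
have [_ uniq_hom] := Gfree G a b.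
have fK : (fun x => val (f x)) =1 id.
  by apply: uniq_hom => //; rewrite ?fa ?fb // => x y; rewrite fM.
by move=> g; rewrite -[g]fK; exact: (valP (f g)).
Qed.

(** * Trace identities for two-by-two matrices *)

Section Mx2.
Variable F : comNzRingType.
Implicit Types A B : 'M[F]_2.

Lemma mx2P A B :
  A 0 0 = B 0 0 -> A 0 1 = B 0 1 -> A 1 0 = B 1 0 -> A 1 1 = B 1 1 -> A = B.
Proof.
move=> e00 e01 e10 e11; apply/matrixP => i j.
have ord2 (k : 'I_2) : k = 0 \/ k = 1.
  by case: k => [[|[|//]]] ?; [left|right]; apply: val_inj.
by case: (ord2 i) => ->; case: (ord2 j) => ->.
Qed.

Lemma mxtrace2 A : \tr A = A 0 0 + A 1 1.
Proof.
by rewrite /mxtrace !big_ord_recl big_ord0 addr0; congr (_ + A _ _); apply: val_inj.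
Qed.

Lemma det2 A : \det A = A 0 0 * A 1 1 - A 0 1 * A 1 0.
Proof.
rewrite (expand_det_row _ 0) !big_ord_recl big_ord0 addr0 /cofactor !det_mx11.
rewrite !mxE /= expr0 mul1r expr1 mulN1r mulrN.
by congr (_ * A _ _ - A _ _ * A _ _); apply: val_inj.
Qed.

Lemma mulmx2 A B i j : (A * B) i j = A i 0 * B 0 j + A i 1 * B 1 j.
Proof.
rewrite mxE !big_ord_recl big_ord0 addr0.
by congr (_ + A _ _ * B _ _); apply: val_inj.
Qed.

Lemma cayley_hamilton2 A : A * A = \tr A *: A - (\det A)%:M.
Proof.
by apply: mx2P; rewrite mulmx2 mxtrace2 det2 !mxE /=; ring.
Qed.

(** Bilinear part of Cayley-Hamilton for A + B. It is the rule that rewrites BA in terms of 1, A, B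
    and AB. *)
Lemma polarized_cayley_hamilton2 A B :
  B * A = (\tr (A * B) - \tr A * \tr B)%:M + \tr B *: A + \tr A *: B - A * B.
Proof.
by apply: mx2P; rewrite !mxtrace2 !(mulmx2, mxE) /=; ring.
Qed.

(** With determinant 1, Cayley-Hamilton reads A (tr A - A) = 1, so inverses stay in the span of 1
    and A. *)
Lemma SL2_mulrI A B : \det A = 1 -> A * B = 1 -> B = (\tr A)%:M - A.
Proof.
move=> dA AB1; have -> : B = (\tr A *: A - A * A) * B.
  by rewrite cayley_hamilton2 dA opprB addrC subrK mul1r.
by rewrite mulrBl -scalerAl -mulrA AB1 mulr1 scalemx1.
Qed.

(** The coordinates need not be determined by the matrix: 1, A, B, AB may be linearly dependent. *)
Definition quat A B (p q r s : F) : 'M[F]_2 :=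
  p%:M + q *: A + r *: B + s *: (A * B).

(** Multiplication table of the span of 1, A, B, AB. The sixteen products reduce by Cayley-Hamilton
    for A, B and AB and its polarization for BA; what matters later is that all coefficients are
    polynomials in the three traces. *)
Lemma quatM A B p q r s p' q' r' s' : \det A = 1 -> \det B = 1 ->
  let x := \tr A in let y := \tr B in let z := \tr (A * B) in
  quat A B p q r s * quat A B p' q' r' s' =
  quat A B
    (p * p' - q * q' + r * q' * (z - x * y) - r * r' - x * (r * s')
       - y * (s * q') - s * s')
    (p * q' + q * p' + x * (q * q') + y * (r * q') + r * s' + z * (s * q')
       - s * r')
    (p * r' + r * p' - q * s' + x * (r * q') + y * (r * r') + z * (r * s')
       + s * q')
    (p * s' + s * p' + q * r' + x * (q * s') - r * q' + y * (s * r')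
       + z * (s * s')).
Proof.
move=> dA dB x y z.
have eAA : A * A = x *: A - 1 by rewrite cayley_hamilton2 dA.
have eBB : B * B = y *: B - 1 by rewrite cayley_hamilton2 dB.
have eBA : B * A = (z - x * y)%:M + y *: A + x *: B - A * B.
  exact: polarized_cayley_hamilton2.
have eCC : A * B * (A * B) = z *: (A * B) - 1.
  by rewrite cayley_hamilton2 det_mulmx dA dB mulr1.
have eAC : A * (A * B) = x *: (A * B) - B.
  by rewrite mulrA eAA mulrBl mul1r scalerAl.
have eCB : A * B * B = y *: (A * B) - A.
  by rewrite -mulrA eBB mulrBr mulr1 scalerAr.
have mulCr c (M : 'M[F]_2) : c%:M * M = c *: M by exact: mul_scalar_mx.
have mulrC' c (M : 'M[F]_2) : M * c%:M = c *: M by exact: mul_mx_scalar.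
have eBC : B * (A * B) = - x%:M + A + z *: B.
  rewrite mulrA eBA mulrBl !mulrDl mulCr -!scalerAl eBB eCB.
  by apply/matrixP=> i j; rewrite !mxE; ring.
have eCA : A * B * A = - y%:M + z *: A + B.
  rewrite -mulrA eBA mulrBr !mulrDr mulrC' -!scalerAr eAA eAC.
  by apply/matrixP=> i j; rewrite !mxE; ring.
rewrite /quat !(mulrDl, mulrDr) !mulCr !mulrC' -!scalerAl -!scalerAr.
rewrite eAA eBB eCC eAC eCB eBC eCA eBA.
set C := A * B; apply/matrixP => i j; rewrite !mxE.
by ring.
Qed.

Lemma mxtrace_quat A B p q r s :
  \tr (quat A B p q r s) = p + p + \tr A * q + \tr B * r + \tr (A * B) * s.
Proof. by rewrite /quat !mxtraceD !mxtraceZ mxtrace_scalar mulr2n; ring. Qed.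

Section Morph.
Variables (S : comNzRingType) (ev : {rmorphism S -> F}) (A B : 'M[F]_2).
Variables x y z : S.
Hypotheses (ev_x : ev x = \tr A) (ev_y : ev y = \tr B) (ev_z : ev z = \tr (A * B)).

(** In the application [ev] evaluates polynomials at the three traces, so the product is computed by
    universal polynomials that do not depend on A and B. *)
Lemma quatM_morph p q r s p' q' r' s' : \det A = 1 -> \det B = 1 ->
  quat A B (ev p) (ev q) (ev r) (ev s) * quat A B (ev p') (ev q') (ev r') (ev s') =
  quat A B
    (ev (p * p' - q * q' + r * q' * (z - x * y) - r * r' - x * (r * s')
       - y * (s * q') - s * s'))
    (ev (p * q' + q * p' + x * (q * q') + y * (r * q') + r * s' + z * (s * q')
       - s * r'))
    (ev (p * r' + r * p' - q * s' + x * (r * q') + y * (r * r') + z * (r * s')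
       + s * q'))
    (ev (p * s' + s * p' + q * r' + x * (q * s') - r * q' + y * (s * r')
       + z * (s * s'))).
Proof.
by move=> dA dB; rewrite quatM // !(rmorphB, rmorphD, rmorphM) ev_x ev_y ev_z.
Qed.

Lemma quatV_morph p q r s :
  let t := \tr (quat A B (ev p) (ev q) (ev r) (ev s)) in
  t%:M - quat A B (ev p) (ev q) (ev r) (ev s) =
  quat A B (ev (p + x * q + y * r + z * s)) (ev (- q)) (ev (- r)) (ev (- s)).
Proof.
have -> : ev (p + x * q + y * r + z * s)
    = \tr (quat A B (ev p) (ev q) (ev r) (ev s)) - ev p.
  by rewrite !(rmorphD, rmorphM) ev_x ev_y ev_z mxtrace_quat; ring.
move=> t; rewrite -/t !(rmorphN ev).
by apply/matrixP => i j; rewrite !mxE; ring.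
Qed.

End Morph.

End Mx2.

(** * Fricke coordinates on the character variety *)

Section Fricke.
Variables (R : realType) (G : groupType) (a b : G).
Hypothesis Gfree : free_on_two a b.

Let word (i : 'I_3) : G := tnth [tuple a; b; (a * b)%g] i.
Let coords (c : G -> R[i]) (i : 'I_3) : R[i] := c (word i).
Let trace_of (rho : G -> 'M[R[i]]_2) (g : G) : R[i] := \tr (rho g).

(** The polynomials [P] are chosen before [rho]: the same four serve all representations. *)
Definition quat_word (g : G) (P : 'I_4 -> {mpoly R[i][3]}) : Prop :=
  forall rho, SL2_rep rho ->
    let e i := (P i).@[coords (trace_of rho)] in
    rho g = quat (rho a) (rho b) (e 0) (e 1) (e 2) (e 3).

Lemma coords_traceE rho : SL2_rep rho ->
  [/\ coords (trace_of rho) 0 = \tr (rho a), coords (trace_of rho) 1 = \tr (rho b)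
    & coords (trace_of rho) 2 = \tr (rho a * rho b)].
Proof.
by move=> [_ _ rhoM]; split; rewrite /coords /trace_of /word (tnth_nth 1%g) //= rhoM.
Qed.

Lemma quat_word_ex g : exists P, quat_word g P.
Proof.
pose tup4 (p q r s : {mpoly R[i][3]}) i := tnth [tuple p; q; r; s] i.
have tup4E p q r s : (tup4 p q r s 0 = p) * (tup4 p q r s 1 = q) *
    (tup4 p q r s 2 = r) * (tup4 p q r s 3 = s).
  by do !split; rewrite /tup4 (tnth_nth 0).
pose x : {mpoly R[i][3]} := 'X_0; pose y : {mpoly R[i][3]} := 'X_1.
pose z : {mpoly R[i][3]} := 'X_2.
pose S h := `[< exists P, quat_word h P >].
suff allS : forall h, S h by exact/asboolP/allS.
apply: (free_on_two_ind Gfree).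
- apply/asboolP; exists (tup4 1 0 0 0) => rho [_ rho1 _] e.
  rewrite /e !tup4E meval0 meval1 /quat rho1.
  by rewrite !scale0r !addr0.
- move=> {}g h /asboolP[P gP] /asboolP[Q hQ]; apply/asboolP.
  exists (tup4
    (P 0 * Q 0 - P 1 * Q 1 + P 2 * Q 1 * (z - x * y) - P 2 * Q 2
      - x * (P 2 * Q 3) - y * (P 3 * Q 1) - P 3 * Q 3)
    (P 0 * Q 1 + P 1 * Q 0 + x * (P 1 * Q 1) + y * (P 2 * Q 1) + P 2 * Q 3
      + z * (P 3 * Q 1) - P 3 * Q 2)
    (P 0 * Q 2 + P 2 * Q 0 - P 1 * Q 3 + x * (P 2 * Q 1) + y * (P 2 * Q 2)
      + z * (P 2 * Q 3) + P 3 * Q 1)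
    (P 0 * Q 3 + P 3 * Q 0 + P 1 * Q 2 + x * (P 1 * Q 3) - P 2 * Q 1
      + y * (P 3 * Q 2) + z * (P 3 * Q 3))).
  move=> rho rhoP e; have [dets _ rhoM] := rhoP.
  have [cx cy cz] := coords_traceE rhoP.
  rewrite rhoM (gP _ rhoP) (hQ _ rhoP).
  rewrite /e; set w := coords _; rewrite -/w in cx cy cz.
  rewrite !tup4E.
  by apply: quatM_morph; rewrite ?dets //= mevalXU.
- move=> {}g /asboolP[P gP]; apply/asboolP.
  exists (tup4 (P 0 + x * P 1 + y * P 2 + z * P 3) (- P 1) (- P 2) (- P 3)).
  move=> rho rhoP e; have [dets rho1 rhoM] := rhoP.
  have [cx cy cz] := coords_traceE rhoP.
  (* The inverse becomes tr - [rho g], which [quatV_morph] expands. *)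
  rewrite (@SL2_mulrI _ (rho g) (rho g^-1%g)) ?dets //; last first.
    by rewrite [LHS](esym (rhoM _ _)) mulgV rho1.
  rewrite (gP _ rhoP) /e; set w := coords _; rewrite -/w in cx cy cz.
  rewrite !tup4E.
  by apply: quatV_morph; rewrite /= mevalXU.
- apply/asboolP; exists (tup4 0 1 0 0) => rho rhoP e.
  rewrite /e !tup4E !meval0 meval1 /quat scale1r !scale0r !addr0.
  by rewrite raddf0 add0r.
- apply/asboolP; exists (tup4 0 0 1 0) => rho rhoP e.
  rewrite /e !tup4E !meval0 meval1 /quat scale1r !scale0r !addr0.
  by rewrite raddf0 add0r.
Qed.

Lemma trace_polynomial g : exists p : {mpoly R[i][3]},
  forall c, character_variety c -> c g = p.@[coords c].
Proof.
have [P gP] := quat_word_ex g.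
exists (P 0 + P 0 + 'X_0 * P 1 + 'X_1 * P 2 + 'X_2 * P 3) => _ [rho rhoP ->].
have [cx cy cz] := coords_traceE rhoP.
by rewrite /= (gP _ rhoP) mxtrace_quat -cx -cy -cz !(mevalD, mevalM, mevalXU).
Qed.

Lemma coords_surj (v : 'I_3 -> R[i]) :
  exists2 c, character_variety c & coords c = v.
Proof.
(* SL_2 is packed as a group, so that freeness turns a choice of two matrices into a
   representation. *)
pose T := {A : 'M[R[i]]_2 | \det A == 1}.
pose sl (A : 'M[R[i]]_2) (dA : \det A == 1) : T :=
  exist (fun A => \det A == 1) A dA.
have det_adj (u : T) : \det (\adj (val u)) == 1.
  apply/eqP; rewrite -[LHS]mul1r -{1}(eqP (valP u)) -det_mulmx mul_mx_adj.
  by rewrite (eqP (valP u)) det1.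
have detM (u w : T) : \det (val u *m val w) == 1.
  by rewrite det_mulmx (eqP (valP u)) (eqP (valP w)) mulr1.
have det_one : \det (1%:M : 'M[R[i]]_2) == 1 by rewrite det1.
pose one : T := sl _ det_one.
pose mul (u w : T) : T := sl _ (detM u w).
pose inv (u : T) : T := sl _ (det_adj u).
have mulA : associative mul by move=> u w t; apply: val_inj; exact: mulmxA.
have mul1 : left_id one mul by move=> u; apply: val_inj; exact: mul1mx.
have mulr1 : right_id one mul by move=> u; apply: val_inj; exact: mulmx1.
have mulV : left_inverse one inv mul.
  by move=> u; apply: val_inj; rewrite /= mul_adj_mx (eqP (valP u)).
have mulrV : right_inverse one inv mul.
  by move=> u; apply: val_inj; rewrite /= mul_mx_adj (eqP (valP u)).
pose H : groupType := HB.pack T (isGroup.Build T mulA mul1 mulr1 mulV mulrV).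
(* [s] and [t] are the roots of X^2 - v_2 X + 1. For the matrices below, det B = st = 1 and tr AB =
   s + t = v_2, while the diagonals give tr A = v_0 and tr B = v_1. *)
pose d := sqrtC (v 2 ^+ 2 - 4); pose s := (v 2 + d) / 2; pose t := (v 2 - d) / 2.
have n2 : (2 : R[i]) != 0 by rewrite pnatr_eq0.
have st1 : s * t = 1.
  have -> : s * t = (v 2 ^+ 2 - d ^+ 2) / 4.
    by rewrite /s /t; field; rewrite ?pnatr_eq0.
  by rewrite sqrtCK opprB addrC subrK mulfV // pnatr_eq0.
have stz : s + t = v 2 by rewrite /s /t; field.
pose A : 'M[R[i]]_2 := \matrix_(i, j)
  if i == 0 then if j == 0 then v 0 else - 1 else if j == 0 then 1 else 0.
pose B : 'M[R[i]]_2 := \matrix_(i, j)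
  if i == 0 then if j == 0 then 0 else t else if j == 0 then - s else v 1.
have dA : \det A == 1 by rewrite det2 !mxE /=; apply/eqP; ring.
have dB : \det B == 1 by rewrite det2 !mxE /= -st1; apply/eqP; ring.
have [[f [fM fa fb]] _] := Gfree (sl A dA : H) (sl B dB : H).
pose rho g := val (f g : T).
have rhoM g h : rho (g * h)%g = rho g *m rho h by rewrite /rho fM.
have rhoP : SL2_rep rho.
  split=> // [g|]; first exact/eqP/(valP (f g : T)).
  suff f1 : f 1%g = 1%g by rewrite /rho f1.
  by apply: (mulgI (f 1%g)); rewrite -fM !mulg1.
exists (trace_of rho); first by exists rho.
have [cx cy cz] := coords_traceE rhoP.
have rho_a : rho a = A by rewrite /rho fa.
have rho_b : rho b = B by rewrite /rho fb.
apply: funext => i.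
have [->|->|->] : [\/ i = 0, i = 1 | i = 2].
  by case: i => [[|[|[|//]]]] ?; [apply: Or31|apply: Or32|apply: Or33];
     apply: val_inj.
- by rewrite cx rho_a mxtrace2 !mxE /=; ring.
- by rewrite cy rho_b mxtrace2 !mxE /=; ring.
- by rewrite cz rho_a rho_b mxtrace2 !mulmx2 !mxE /= -stz; ring.
Qed.

(** Since every value of a character is a polynomial in its coordinates, the coordinates separate
    characters and generate the regular functions; conversely they are themselves evaluations at
    [a], [b] and [ab]. *)
Lemma character_variety_free2 : character_variety_is_affine_space R G 3.
Proof.
exists coords; split.
  split=> //.
    move=> c c' /set_mem cV /set_mem c'V ecc'; apply: funext => g.
    have [p gp] := trace_polynomial g.
    by rewrite (gp _ cV) (gp _ c'V) ecc'.
  by move=> v _; have [c cV cv] := coords_surj v; exists c.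
move=> f; split=> [[n [g [p fp]]]|[p fp]]; last by exists 3, word, p.
have /choice[q gq] := fun i => trace_polynomial (g i).
exists (p \mPo [tuple q i | i < n]) => c cV.
rewrite fp // comp_mpoly_meval; apply: meval_eq => i.
by rewrite tnth_mktuple gq.
Qed.

End Fricke.

(** * Traces and bases *)

Section Action.
Variables (A : comNzRingType) (V : zmodType) (act : A -> V -> V).

(** Stated for an explicit action, so that the results below serve both [chi_act] and complex
    scaling. *)
Definition module_action : Prop :=
  [/\ forall v, {morph act^~ v : a b / a + b},
      forall a, {morph act a : u v / u + v},
      forall a b v, act (a * b) v = act a (act b v)
    & forall v, act 1 v = v].

(** Any finite index type is allowed, because the bases below are indexed by exponent functions or
    by common roots; spanning and independence are separated as they are proved separately. *)
Definition fin_basis (I : finType) (e : I -> V) : Prop :=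
  (forall v, exists c, v = \sum_i act (c i) (e i)) /\
  (forall c, \sum_i act (c i) (e i) = 0 -> forall i, c i = 0).

Hypothesis actP : module_action.

Lemma act0l v : act 0 v = 0.
Proof.
have [actDl _ _ _] := actP.
by apply: (addIr (act 0 v)); rewrite add0r -actDl addr0.
Qed.

Lemma act0r a : act a 0 = 0.
Proof.
have [_ actDr _ _] := actP.
by apply: (addIr (act a 0)); rewrite add0r -actDr addr0.
Qed.

Lemma actBl a b v : act (a - b) v = act a v - act b v.
Proof.
have [actDl _ _ _] := actP.
by apply: (addIr (act b v)); rewrite -actDl !subrK.
Qed.

Lemma act_suml (I : Type) (r : seq I) (P : pred I) F v :
  act (\sum_(i <- r | P i) F i) v = \sum_(i <- r | P i) act (F i) v.
Proof.
have [actDl _ _ _] := actP.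
exact: (big_morph (act^~ v) (actDl v) (act0l v)).
Qed.

Lemma act_sumr (I : Type) (r : seq I) (P : pred I) F a :
  act a (\sum_(i <- r | P i) F i) = \sum_(i <- r | P i) act a (F i).
Proof.
have [_ actDr _ _] := actP.
exact: (big_morph (act a) (actDr a) (act0r a)).
Qed.

Lemma act_delta (I : finType) (e : I -> V) j :
  \sum_i act (j == i)%:R (e i) = e j.
Proof.
have [_ _ _ act1] := actP.
rewrite (bigD1 j) //= eqxx act1 big1 ?addr0 // => i.
by rewrite eq_sym => /negPf ->; rewrite act0l.
Qed.

Lemma act_mulmx (I : finType) m n (C : 'M_(m, n)) (D : 'I_n -> I -> A) (e : I -> V) j :
  \sum_k act (C j k) (\sum_i act (D k i) (e i)) =
  \sum_i act (\sum_k C j k * D k i) (e i).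
Proof.
have [_ _ actA _] := actP.
under eq_bigr do rewrite act_sumr.
rewrite exchange_big; apply: eq_bigr => i _; rewrite act_suml.
by apply: eq_bigr => k _; rewrite actA.
Qed.

Lemma basis_inj n (e : 'I_n -> V) (c d : 'I_n -> A) : is_basis act e ->
  \sum_i act (c i) (e i) = \sum_i act (d i) (e i) -> c =1 d.
Proof.
move=> /(_ (\sum_i act (c i) (e i)))[x [_ uniq_x]] ecd i.
have xc : x = \row_i c i by apply: uniq_x; apply: eq_bigr => k _; rewrite mxE.
have xd : x = \row_i d i.
  by apply: uniq_x; rewrite ecd; apply: eq_bigr => k _; rewrite mxE.
by have /rowP/(_ i) := etrans (esym xc) xd; rewrite !mxE.
Qed.

Lemma basis_coords n m (e : 'I_n -> V) (w : 'I_m -> V) : is_basis act e ->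
  exists C : 'M[A]_(m, n), forall j, w j = \sum_i act (C j i) (e i).
Proof.
move=> be; have /choice[C hC] : forall j, exists c : 'rV[A]_n,
    w j = \sum_i act (c 0 i) (e i).
  by move=> j; have [c [hc _]] := be (w j); exists c.
by exists (\matrix_j C j) => j; rewrite hC; apply: eq_bigr => i _; rewrite mxE.
Qed.

Section Trace.
Variable f : V -> V.
Hypotheses (fD : {morph f : u v / u + v}) (fZ : forall a v, f (act a v) = act a (f v)).

(** The change-of-basis matrices P and Q are mutually inverse but a priori rectangular, so the two
    traces are compared by cyclicity of the trace. *)
Lemma is_trace_inj t u : is_trace act f t -> is_trace act f u -> t = u.
Proof.
case=> n [e [M [be fe ->]]] [m [e' [M' [be' fe' ->]]]].
have [_ _ actA _] := actP.
have f_sum k (c : 'I_k -> A) (w : 'I_k -> V) :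
    f (\sum_i act (c i) (w i)) = \sum_i act (c i) (f (w i)).
  have f0 : f 0 = 0 by apply: (addIr (f 0)); rewrite add0r -fD addr0.
  by rewrite (big_morph f fD f0); apply: eq_bigr => i _; rewrite fZ.
have [P hP] := basis_coords e' be; have [Q hQ] := basis_coords e be'.
have QP : Q *m P = 1%:M.
  apply/matrixP => i j; rewrite !mxE.
  apply: (basis_inj (c := fun j => \sum_k Q i k * P k j)
    (d := fun j => (i == j)%:R) be).
  by rewrite act_delta [RHS]hQ -act_mulmx; apply: eq_bigr => k _; rewrite -hP.
have PQ : P *m Q = 1%:M.
  apply/matrixP => i j; rewrite !mxE.
  apply: (basis_inj (c := fun j => \sum_k P i k * Q k j)
    (d := fun j => (i == j)%:R) be').
  by rewrite act_delta [RHS]hP -act_mulmx; apply: eq_bigr => k _; rewrite -hQ.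
(* Row i of either side lists the coordinates of [f (e' i)] in the basis [e]; the transposes appear
   because P stores coordinates in rows and M in columns. *)
have PM : P *m M^T = M'^T *m P.
  apply/matrixP => i j; rewrite !mxE.
  apply: (basis_inj (c := fun j => \sum_k P i k * M^T k j)
    (d := fun j => \sum_k M'^T i k * P k j) be).
  rewrite -!act_mulmx.
  transitivity (f (e' i)).
    rewrite hP f_sum; apply: eq_bigr => k _; rewrite fe; congr act.
    by apply: eq_bigr => l _; rewrite mxE.
  by rewrite fe'; apply: eq_bigr => k _; rewrite mxE -hP.
by rewrite -(mxtrace_tr M) -(mxtrace_tr M') -[M'^T]mulmx1 -PQ mulmxA -PM
     -mulmxA mxtrace_mulC -mulmxA QP mulmx1.
Qed.

Lemma mod_traceE t : is_trace act f t -> mod_trace act f = t.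
Proof. by move=> ft; apply: xget_unique => // u fu; exact: is_trace_inj. Qed.

End Trace.

Section FinBasis.
Variables (I : finType) (e : I -> V).
Hypothesis be : fin_basis e.

Lemma sum_enum_val (c : I -> A) :
  \sum_i act (c i) (e i) = \sum_(k < #|I|) act (c (enum_val k)) (e (enum_val k)).
Proof.
rewrite (reindex (@enum_val I predT)) //.
by apply: onW_bij; exact: enum_val_bij.
Qed.

Lemma fin_basisP : is_basis act (fun k : 'I_#|I| => e (enum_val k)).
Proof.
have [spane free_e] := be; move=> v; have [c ->] := spane v.
exists (\row_k c (enum_val k)); split=> [|d].
  by rewrite sum_enum_val; apply: eq_bigr => k _; rewrite mxE.
move=> ed; apply/rowP => k; rewrite mxE.
pose x i := c i - d 0 (enum_rank i).
have /free_e/(_ (enum_val k))/eqP : \sum_i act (x i) (e i) = 0.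
  rewrite /x; under eq_bigr do rewrite actBl.
  rewrite sumrB ed sum_enum_val; apply/eqP; rewrite subr_eq0; apply/eqP.
  by apply: eq_bigr => j _; rewrite enum_valK.
by rewrite /x enum_valK subr_eq0 => /eqP.
Qed.

Lemma fin_basis_trace f (M : I -> I -> A) : {morph f : u v / u + v} ->
  (forall a v, f (act a v) = act a (f v)) ->
  (forall j, f (e j) = \sum_i act (M i j) (e i)) ->
  mod_trace act f = \sum_i M i i.
Proof.
move=> fD fZ fe; apply: mod_traceE => //.
exists #|I|, (fun k : 'I_#|I| => e (enum_val k)).
exists (\matrix_(i, j) M (enum_val i) (enum_val j)); split.
- exact: fin_basisP.
- by move=> j; rewrite fe sum_enum_val; apply: eq_bigr => i _; rewrite mxE.
rewrite (reindex (@enum_val I predT)); last by apply: onW_bij; exact: enum_val_bij.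
by apply: eq_bigr => k _; rewrite mxE.
Qed.

End FinBasis.

End Action.

(** * Tchebychev polynomials and interpolation *)

(* Tchebychev polynomials of the second kind, shifted so that [chebU n] has
   degree n - 1. *)
Fixpoint chebU (A : pzRingType) (n : nat) (x : A) : A :=
  match n with
  | 0 => 0
  | S m => match m with
           | 0 => 1
           | S k => x * chebU m x - chebU k x
           end
  end.

Lemma tchebSS (A : pzRingType) n (x : A) : tcheb n.+2 x = x * tcheb n.+1 x - tcheb n x.
Proof. by []. Qed.

Lemma chebUSS (A : pzRingType) n (x : A) : chebU n.+2 x = x * chebU n.+1 x - chebU n x.
Proof. by []. Qed.

Section Tchebychev.
Variable A : comNzRingType.
Implicit Types x : A.

(** For x = q + 1/q this is q^n + q^-n written through U_n = (q^n - q^-n) / (q - 1/q). *)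
Lemma tcheb_chebU n x : tcheb n x = 2 * chebU n.+1 x - x * chebU n x.
Proof.
elim/ltn_ind: n => -[|[|n]] IH.
- by rewrite /= mulr1 mulr0 subr0.
- by rewrite /=; ring.
- by rewrite tchebSS !IH // !chebUSS; ring.
Qed.

(** The quadratic form s^2 - x s t + t^2 is preserved by the recursion step (s, t) -> (x s - t, s)
    and equals 1 at (1, 0). *)
Lemma chebU_invariant n x :
  chebU n.+1 x ^+ 2 - x * chebU n.+1 x * chebU n x + chebU n x ^+ 2 = 1.
Proof. by elim: n => [|n IH]; [rewrite /=; ring | rewrite -[RHS]IH chebUSS; ring]. Qed.

Lemma tcheb_sqr n x : tcheb n x ^+ 2 = 4 + (x ^+ 2 - 4) * chebU n x ^+ 2.
Proof.
rewrite tcheb_chebU; have := chebU_invariant n x.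
move: (chebU n.+1 x) (chebU n x) => s t e.
transitivity (4 * (s ^+ 2 - x * s * t + t ^+ 2) + (x ^+ 2 - 4) * t ^+ 2).
  by ring.
by rewrite e mulr1.
Qed.

End Tchebychev.

Lemma deriv_tcheb (A : comNzRingType) n :
  (tcheb n ('X : {poly A}))^`() = n%:R * chebU n 'X.
Proof.
elim/ltn_ind: n => -[|[|n]] IH.
- by rewrite mul0r /= -polyC_natr derivC.
- by rewrite /= derivX mul1r.
- rewrite tchebSS derivB derivM derivX !IH //.
  rewrite (tcheb_chebU _ ('X : {poly A})) !chebUSS !mulrS.
  by ring.
Qed.

(** A root x of T_n - u that is also a root of its derivative n U_n has U_n(x) = 0, so the Pell
    identity [tcheb_sqr] gives u^2 = 4, which is excluded. Hence the polynomial is separable. *)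
Lemma tcheb_split (F : numClosedFieldType) n (u : F) : (0 < n)%N -> u != 2 -> u != - 2 ->
  exists z : 'I_n -> F, injective z /\
    exists2 c, c != 0 & tcheb n 'X - u%:P = c *: \prod_i ('X - (z i)%:P).
Proof.
case: n => // n _ u2 uN2; set p := _ - _.
have sz : size p = n.+2.
  by rewrite size_polyDl size_tcheb // size_polyN (leq_ltn_trans (size_polyC_leq1 u)).
have p0 : lead_coef p != 0 by rewrite lead_coef_eq0 -size_poly_gt0 sz.
have sep : separable_poly p.
  rewrite unlock; apply/Pdiv.ClosedField.coprimepP => x.
  have tx : (tcheb n.+1 'X).[x] = tcheb n.+1 x.
    rewrite -[in RHS](hornerX x); exact: (tcheb_morph (horner_eval x) n.+1 'X).
  rewrite rootE hornerD hornerN hornerC tx subr_eq0 => /eqP ux.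
  rewrite derivB derivC subr0 deriv_tcheb hornerM -polyC_natr hornerC.
  rewrite mulf_eq0 negb_or pnatr_eq0 /=; apply/negP => /eqP Ux.
  have := congr1 (horner_eval x) (tcheb_sqr n.+1 ('X : {poly F})).
  rewrite rmorphXn rmorphD rmorphM rmorphXn /= {1 4}/horner_eval tx Ux ux.
  rewrite expr0n mulr0 addr0 rmorph_nat => /eqP.
  have -> : 4 = 2 ^+ 2 :> F by ring.
  rewrite eqf_sqr.
  by rewrite (negPf u2) (negPf uN2).
have [r pr] := closed_field_poly_normal p.
have uniq_r : uniq r.
  rewrite -separable_prod_XsubC.
  by move: sep; rewrite {1}pr (eqp_separable (eqp_scale _ p0)).
have size_r : size r == n.+1.
  by move: sz; rewrite {1}pr size_scale // size_prod_XsubC => -[->].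
exists (tnth (Tuple size_r)); split; first exact/tuple_uniqP.
exists (lead_coef p) => //.
by rewrite -(big_tuple _ _ (Tuple size_r) xpredT (fun z => 'X - z%:P)).
Qed.

(** * Lagrange interpolation and expansion in powers of a polynomial *)

Section Interpolation.
Variables (F : fieldType) (n : nat) (z : 'I_n -> F).
Hypothesis z_inj : injective z.

Definition lagrange (k : 'I_n) : {poly F} :=
  \prod_(i | i != k) ((z k - z i)^-1 *: ('X - (z i)%:P)).

Lemma lagrangeE k l : (lagrange k).[z l] = (l == k)%:R.
Proof.
rewrite horner_prod; have [->|lk] := eqVneq l k.
  rewrite big1 // => i ik; rewrite hornerZ hornerXsubC mulVf // subr_eq0.
  by rewrite (inj_eq z_inj) eq_sym.
by rewrite (bigD1 l) //= hornerZ hornerXsubC subrr mulr0 mul0r.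
Qed.

(** The difference between f and its interpolant vanishes at the n distinct points, so their product
    divides it. *)
Lemma lagrange_interpolation (f : {poly F}) :
  exists q, f = \sum_k f.[z k] *: lagrange k + q * \prod_i ('X - (z i)%:P).
Proof.
set g := \sum_k _.
have : \prod_(x <- [seq z i | i : 'I_n]) ('X - x%:P) %| f - g.
  apply: uniq_roots_dvdp.
    apply/allP => _ /mapP[l _ ->]; rewrite rootE hornerD hornerN subr_eq0.
    rewrite horner_sum (bigD1 l) //= hornerZ lagrangeE eqxx mulr1 big1 ?addr0 //.
    by move=> k kl; rewrite hornerZ lagrangeE eq_sym (negPf kl) mulr0.
  by rewrite uniq_rootsE map_inj_uniq ?enum_uniq.
rewrite big_map big_enum /= => /dvdpP[q fg]; exists q.
by rewrite -fg addrC subrK.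
Qed.

End Interpolation.

(** Expansion of f in base T, by repeated Euclidean division; the coefficients are then regrouped by
    the power of X. *)
Lemma poly_expansion (F : fieldType) (T f : {poly F}) n : size T = n.+2 ->
  exists g : 'I_n.+1 -> {poly F}, f = \sum_j (g j \Po T) * 'X^j.
Proof.
move=> sT; have T0 : T != 0 by rewrite -size_poly_gt0 sT.
move: {2}(size f).+1 (ltnSn (size f)) => m; elim: m f => // m IH f fm.
have [->|f0] := eqVneq f 0.
  by exists (fun=> 0); rewrite big1 // => j _; rewrite comp_poly0 mul0r.
have [|g fg] := IH (f %/ T).
  move: fm; rewrite ltnS size_divp // sT; apply: leq_trans.
  by rewrite ltn_subrL size_poly_gt0 f0.
(* Multiplying the quotient by T multiplies each [g j] by X, and the remainder supplies the constant
   terms. *)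
exists (fun j => g j * 'X + ((f %% T)`_j)%:P).
have modE : f %% T = \sum_(j < n.+1) (f %% T)`_j *: 'X^j.
  rewrite -poly_def; apply/polyP => i; rewrite coef_poly.
  case: ltnP => // ni; rewrite nth_default // (leq_trans _ ni) //.
  by rewrite -ltnS -sT ltn_modpN0.
rewrite {1}(divp_eq f T) {1}fg mulr_suml {1}modE -big_split.
apply: eq_bigr => j _; rewrite comp_polyD comp_polyM comp_polyX comp_polyC.
by rewrite mulrDl mul_polyC mulrAC.
Qed.

(** * The skein algebra over chi *)

Section Leads.
Variables (n : nat) (F : idomainType).
Implicit Types p : {mpoly F[n]}.

(** With distinct leading monomials the largest one cannot cancel. *)
Lemma mlead_sum_uniq (T : eqType) (x : T) (r : seq T) (P : T -> {mpoly F[n]}) :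
  (forall y, y \in x :: r -> P y != 0) -> uniq [seq mlead (P y) | y <- x :: r] ->
  \sum_(y <- x :: r) P y != 0 /\
  exists2 y, y \in x :: r & mlead (\sum_(y <- x :: r) P y) = mlead (P y).
Proof.
elim: r x => [|x' r IH] x nzP.
  by rewrite big_seq1 => _; split; [apply: nzP | exists x]; rewrite ?mem_head.
rewrite map_cons cons_uniq => /andP[xr uniq_r]; rewrite big_cons.
have [|s0 [y yr sy]] := IH x' _ uniq_r.
  by move=> y yr; apply: nzP; rewrite in_cons yr orbT.
set s := \sum_(_ <- _) _ in s0 sy *.
have lead_neq : mlead (P x) != mlead s.
  by apply: contraNneq xr => ->; rewrite sy; apply/mapP; exists y.
split.
  apply: contraNneq lead_neq => /eqP.
  by rewrite addr_eq0 => /eqP ->; rewrite mleadN.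
case: (ltgtP (mlead (P x)) (mlead s)) lead_neq => // lt_lead _.
  by exists y; [rewrite in_cons yr orbT | rewrite mleadDr].
by exists x; [rewrite mem_head | rewrite mleadDl].
Qed.

(** The term x T_(k+1) dominates the recursion. The assumption on 2 makes T_0 = 2 nonzero. *)
Lemma mlead_tcheb (i : 'I_n) k : (2 : F) != 0 ->
  tcheb k ('X_i : {mpoly F[n]}) != 0 /\
  mlead (tcheb k ('X_i : {mpoly F[n]})) = (U_(i) *+ k)%MM.
Proof.
move=> F2; elim/ltn_ind: k => -[|[|k]] IH.
- have -> : tcheb 0 'X_i = (2 : F)%:MP_[n] by rewrite /= mpolyC_nat.
  by rewrite mpolyC_eq0 F2 mleadC mulm0n.
- rewrite /= mleadXm mulm1n; split=> //.
  by rewrite -mleadc_eq0 mleadXm mcoeffX eqxx oner_eq0.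
have [nz1 l1] := IH k.+1 (ltnSn _).
have [nz0 l0] := IH k (leqW (ltnSn _)).
have nzX : 'X_i != 0 :> {mpoly F[n]}.
  by rewrite -mleadc_eq0 mleadXm mcoeffX eqxx oner_eq0.
have lX : mlead ('X_i * tcheb k.+1 'X_i : {mpoly F[n]}) = (U_(i) *+ k.+2)%MM.
  by rewrite mleadM // mleadXm l1 -mulmS.
have lt02 : ((U_(i) *+ k)%MM < (U_(i) *+ k.+2)%MM :> 'X_{1..n})%O.
  by apply: lt_mdeg_ltmc; rewrite !mdegMn mdeg1 !mul1n.
have l2 : mlead (tcheb k.+2 'X_i : {mpoly F[n]}) = (U_(i) *+ k.+2)%MM.
  by rewrite tchebSS mleadDl ?mleadN ?lX ?l0.
split=> //; apply: contraTneq lt02 => e0.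
by rewrite -l2 e0 mlead0 -leNgt le0m.
Qed.

End Leads.

Lemma horner_alg_morph (K : nzRingType) (A B : algType K)
  (f : {lrmorphism A -> B}) a (p : {poly K}) :
  f (horner_alg a p) = horner_alg (f a) p.
Proof.
elim/poly_ind: p => [|p c IH]; first by rewrite !rmorph0.
by rewrite !rmorphD !rmorphM /= IH !horner_algX !horner_algC rmorph_alg.
Qed.

Lemma horner_alg_comp (K : comNzRingType) (A : algType K) (a : A) (p q : {poly K}) :
  horner_alg a (p \Po q) = horner_alg (horner_alg a q) p.
Proof.
elim/poly_ind: p => [|p c IH]; first by rewrite comp_poly0 !rmorph0.
rewrite comp_polyD comp_polyM comp_polyX comp_polyC !rmorphD !rmorphM /= IH.
by rewrite !horner_algX !horner_algC.
Qed.

Lemma horner_alg_tcheb (K : comNzRingType) (A : algType K) (a : A) n :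
  horner_alg a (tcheb n 'X) = tcheb n a.
Proof.
rewrite -[in RHS](horner_algX a).
exact: (tcheb_morph (horner_alg a) n 'X).
Qed.

Section ChiVal.
Variables (R : realType) (N : nat).

Fact chi_val_zmod : zmod_morphism (@chi_val R N). Proof. by []. Qed.
Fact chi_val_monoid : monoid_morphism (@chi_val R N). Proof. by []. Qed.
Fact chi_val_scalable : scalable (@chi_val R N). Proof. by []. Qed.

HB.instance Definition _ := GRing.isZmodMorphism.Build _ _ _ chi_val_zmod.
HB.instance Definition _ := GRing.isMonoidMorphism.Build _ _ _ chi_val_monoid.
HB.instance Definition _ := GRing.isScalable.Build _ _ _ _ _ chi_val_scalable.

End ChiVal.

(** * The monomial basis over chi *)

Section Skein.
Variables (R : realType) (N : nat).
Hypothesis N_gt0 : (0 < N)%N.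
Local Notation S := (skein R).

Lemma chi_action : module_action (@chi_act R N).
Proof.
split=> [v a b | a u v | a b v | v]; rewrite /chi_act.
- by rewrite rmorphD mulrDl.
- by rewrite mulrDr.
- by rewrite rmorphM mulrA.
- by rewrite rmorph1 mul1r.
Qed.

(** These N^3 monomials stand in for the products T_j(x) T_k(y) T_l(z); the trace is the same in
    either basis. *)
Definition monomial (h : {ffun 'I_3 -> 'I_N}) : S := \prod_i 'X_i ^+ h i.

(** Expansion of X^k in base T_N, with the coefficients evaluated at the generator T_N(x_i) of
    [chi]. *)
Lemma var_expansion (i : 'I_3) k : exists c : 'I_N -> chi R N,
  ('X_i : S) ^+ k = \sum_j chi_val (c j) * 'X_i ^+ j.
Proof.
case: N N_gt0 => // n _.
have [g gP] := @poly_expansion R[i] _ 'X^k n (size_tcheb _ n).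
exists (fun j => horner_alg (chi_gen R n.+1 i) (g j)).
have -> : ('X_i : S) ^+ k = horner_alg 'X_i 'X^k by rewrite rmorphXn /= horner_algX.
rewrite {1}gP rmorph_sum; apply: eq_bigr => j _.
rewrite rmorphM rmorphXn /= horner_algX; congr (_ * _).
have -> := horner_alg_morph
  [the {lrmorphism chi R n.+1 -> S} of @chi_val R n.+1] (chi_gen R n.+1 i) (g j).
rewrite horner_alg_comp.
by congr (horner_alg _ _); exact: (horner_alg_tcheb _ n.+1).
Qed.


Lemma monomial_span v : exists c : {ffun 'I_3 -> 'I_N} -> chi R N,
  v = \sum_h chi_act (c h) (monomial h).
Proof.
have /choice[c cP] : forall ik : 'I_3 * nat, exists c : 'I_N -> chi R N,
    ('X_ik.1 : S) ^+ ik.2 = \sum_j chi_val (c j) * 'X_ik.1 ^+ j.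
  by move=> ik; exact: var_expansion.
exists (fun h => \sum_(m <- msupp v) v@_m *: \prod_i c (i, m i) (h i)).
transitivity (\sum_(m <- msupp v) \sum_(h : {ffun 'I_3 -> 'I_N})
    chi_val (v@_m *: \prod_i c (i, m i) (h i)) * monomial h); last first.
  rewrite exchange_big; apply: eq_bigr => h _.
  by rewrite /chi_act rmorph_sum mulr_suml.
rewrite {1}[v]mpolyE; apply: eq_bigr => m _.
rewrite mpolyXE_id; under eq_bigr do rewrite (cP (_, _)).
rewrite bigA_distr_bigA scaler_sumr; apply: eq_bigr => h _.
by rewrite linearZ rmorph_prod big_split -scalerAl.
Qed.

(** An element of [chi] is a combination of products of powers of the T_N(x_i). The product with
    exponents m has leading exponent N m, so distinct products have distinct leading monomials. *)
Lemma chi_lead (c : chi R N) : c != 0 ->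
  chi_val c != 0 /\ exists m, mlead (chi_val c) = (m *+ N)%MM.
Proof.
move=> c0; have vc0 : chi_val c != 0.
  by apply: contraNneq c0 => c0; apply/eqP/val_inj.
split=> //; have /asboolP[p cp] := valP c; rewrite /= in cp.
have p0 : p != 0 by apply: contraNneq vc0 => p0; rewrite cp p0 /threading rmorph0.
have n2 : (2 : R[i]) != 0 by rewrite pnatr_eq0.
pose F m : S := p@_m *: \prod_i tcheb N 'X_i ^+ m i.
have T0 i : tcheb N ('X_i : S) != 0 by have [] := mlead_tcheb i N n2.
have F0 m : m \in msupp p -> F m != 0.
  rewrite mcoeff_msupp => pm; rewrite scaler_eq0 negb_or pm /=.
  by apply/prodf_neq0 => i _; rewrite expf_neq0.
have leadF m : m \in msupp p -> mlead (F m) = (m *+ N)%MM.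
  rewrite mcoeff_msupp => pm; rewrite mleadZ // mlead_prod => [|i _ _]; last first.
    by rewrite expf_neq0.
  apply/mnmP => j; rewrite mnm_sumE mulmnE (bigD1 j) //= big1 => [|i ij].
    rewrite mleadX // (mlead_tcheb j N n2).2 !mulmnE mnm1E eqxx mul1n addn0 //.
    by rewrite mulnC.
  by rewrite mleadX // (mlead_tcheb i N n2).2 !mulmnE mnm1E (negPf ij).
have cF : chi_val c = \sum_(m <- msupp p) F m.
  rewrite cp /threading comp_mpolyE; apply: eq_bigr => m _; congr (_ *: _).
  by apply: eq_bigr => i _; rewrite tnth_mktuple.
case sp: (msupp p) => [|m0 r].
  by move: p0; rewrite -msupp_eq0 sp.
have [||_ [m mp leadc]] := @mlead_sum_uniq _ _ _ m0 r F.
- by move=> m; rewrite -sp; exact: F0.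
- rewrite -sp map_inj_in_uniq ?msupp_uniq // => m m' mp m'p.
  rewrite !leadF // => e; apply/mnmP => i.
  have := congr1 (fun t : 'X_{1..3} => t i) e; rewrite !mulmnE => /eqP.
  by rewrite eqn_pmul2r // => /eqP.
by exists m; rewrite cF sp leadc leadF // sp.
Qed.

(** Leading exponents in [chi] are divisible by N, so the leading exponent of a nonzero summand is
    congruent to h modulo N. Distinct h thus give distinct leading monomials, and the sum cannot
    vanish. *)
Lemma monomial_free (c : {ffun 'I_3 -> 'I_N} -> chi R N) :
  \sum_h chi_act (c h) (monomial h) = 0 -> forall h, c h = 0.
Proof.
move=> sum0 h0; apply/eqP/negPn/negP => ch0.
pose r := [seq h <- index_enum {ffun 'I_3 -> 'I_N} | c h != 0].
have rP h : (h \in r) = (c h != 0) by rewrite mem_filter mem_index_enum andbT.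
pose F h := chi_act (c h) (monomial h).
have nzX (i : 'I_3) : 'X_i != 0 :> S.
  by rewrite -mleadc_eq0 mleadXm mcoeffX eqxx oner_eq0.
have mono0 h : monomial h != 0 by apply/prodf_neq0 => i _; rewrite expf_neq0.
have lead_mono h i : mlead (monomial h) i = h i.
  rewrite mlead_prod => [|k _ _]; last by rewrite expf_neq0.
  rewrite mnm_sumE (bigD1 i) //= big1 => [|k ki].
    by rewrite mleadX // mleadXm mulmnE mnm1E eqxx mul1n addn0.
  by rewrite mleadX // mleadXm mulmnE mnm1E (negPf ki).
have sumF : \sum_(h <- r) F h = 0.
  rewrite -[RHS]sum0 [RHS](bigID (fun h => c h != 0)) /= big_filter.
  rewrite [X in _ = _ + X]big1 ?addr0 // => h; rewrite negbK => /eqP ->.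
  exact: (act0l chi_action).
have := rP h0; rewrite ch0.
have uniq_r : uniq r by rewrite filter_uniq ?index_enum_uniq.
case: r uniq_r rP sumF => [//|h1 r] uniq_r rP sumF _.
have [||/eqP] := @mlead_sum_uniq _ _ _ h1 r F; last by rewrite sumF.
- move=> h; rewrite rP => ch.
  by apply: mulf_neq0; [exact: (chi_lead ch).1 | exact: mono0].
- rewrite map_inj_in_uniq // => h h'; rewrite !rP => ch ch'.
  have [c0 [m cm]] := chi_lead ch; have [c0' [m' cm']] := chi_lead ch'.
  rewrite /F /chi_act !mleadM // cm cm' => e; apply/ffunP => i; apply: val_inj.
  have := congr1 (fun t : 'X_{1..3} => t i %% N)%N e.
  by rewrite !mnmDE !mulmnE !modnMDl !lead_mono !modn_small.
Qed.

Lemma monomial_basis : fin_basis (@chi_act R N) monomial.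
Proof. by split; [exact: monomial_span | exact: monomial_free]. Qed.

End Skein.

(** * Specialization *)

Lemma scale_action (K : comNzRingType) (V : lmodType K) :
  module_action ( *:%R : K -> V -> V).
Proof.
split=> [v a b | a u v | a b v | v].
- exact: scalerDl.
- exact: scalerDr.
- by rewrite scalerA.
- exact: scale1r.
Qed.

Section Spec.
Variables (R : realType) (N : nat).
Hypothesis N_gt0 : (0 < N)%N.
Variable phi : place R N.
Local Notation S := (skein R).
Local Notation I := {ffun 'I_3 -> 'I_N}.
Local Notation pi := (spec_pi phi).

Lemma spec_pi_surj (u : spec phi) : exists a, u = pi a.
Proof. by exists (repr u); rewrite /spec_pi reprK. Qed.

Lemma spec_pi_eq0 a : pi a = 0 <-> a \in place_ideal phi.
Proof.
rewrite -[0](rmorph0 (spec_pi phi)) /spec_pi; split.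
  by move/eqP; rewrite -Quotient.idealrBE subr0.
by move=> aI; apply/eqP; rewrite -Quotient.idealrBE subr0.
Qed.

Lemma spec_piZ c a : pi (c *: a) = c *: pi a.
Proof. by rewrite -mul_mpolyC rmorphM. Qed.

Lemma place_alg k : phi k%:A = k.
Proof. by rewrite linearZ rmorph1 /= mulr1. Qed.

Lemma spec_pi_chi (c : chi R N) a : pi (chi_val c * a) = phi c *: pi a.
Proof.
apply/eqP; rewrite -subr_eq0 -spec_piZ -rmorphB; apply/eqP/spec_pi_eq0/asboolP.
(* c - [phi c] lies in the kernel of [phi]. *)
exists [:: (c - (phi c)%:A, a)].
  by move=> u; rewrite inE => /eqP -> /=; rewrite rmorphB /= place_alg subrr.
by rewrite big_seq1 /= mulrBl -scalerAl mul1r.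
Qed.

(** For independence, a relation in the quotient lifts to an element of the ideal. Its coordinates
    over [chi] lie in the kernel of [phi], and they coincide with the lifted scalars. *)
Lemma spec_fin_basis : fin_basis ( *:%R : R[i] -> spec phi -> spec phi)
  (fun h : I => pi (monomial R h)).
Proof.
have [span free] := monomial_basis R N_gt0; split.
  move=> u; have [a ->] := spec_pi_surj u; have [c ->] := span a.
  exists (fun h => phi (c h)); rewrite rmorph_sum; apply: eq_bigr => h _.
  exact: spec_pi_chi.
move=> d sum0 h.
have /spec_pi_eq0/asboolP[s s0 ds] : pi (\sum_h d h *: monomial R h) = 0.
  by rewrite rmorph_sum -[RHS]sum0; apply: eq_bigr => k _; rewrite /= spec_piZ.
have /choice[C hC] := fun u : chi R N * S => span u.2.
have /free/(_ h)/(congr1 phi) : \sum_h chi_act ((d h)%:A - \sum_(u <- s) u.1 * C u h)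
    (monomial R h) = 0.
  under eq_bigr do rewrite (actBl (chi_action R N)) (act_suml (chi_action R N)).
  rewrite sumrB; apply/eqP; rewrite subr_eq0; apply/eqP.
  transitivity (\sum_h d h *: monomial R h).
    by apply: eq_bigr => k _; rewrite /chi_act rmorph_alg -scalerAl mul1r.
  rewrite ds exchange_big; apply: eq_bigr => u _; rewrite {1}hC mulr_sumr.
  by apply: eq_bigr => k _; rewrite /chi_act rmorphM mulrA.
rewrite rmorphB rmorph0 /= place_alg rmorph_sum big_seq big1 ?subr0 // => u us.
by rewrite rmorphM /= s0 // mul0r.
Qed.

(** Multiplication by [pi a] has, in the specialized monomial basis, the matrix of multiplication by
    [a] with [phi] applied to each entry. *)
Lemma spec_trace_pi a : spec_trace (pi a) = phi (mod_trace (@chi_act R N) ( *%R a)).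
Proof.
have [span _] := monomial_basis R N_gt0.
have /choice[M hM] := fun j : I => span (a * monomial R j).
rewrite /spec_trace.
rewrite (fin_basis_trace (chi_action R N) (monomial_basis R N_gt0)
  (M := fun i j => M j i)) //.
- rewrite (fin_basis_trace (scale_action _) spec_fin_basis (M := fun i j => phi (M j i))).
  + by rewrite rmorph_sum.
  + by move=> u v; rewrite mulrDr.
  + by move=> c v; rewrite -scalerAr.
  + move=> j; rewrite -rmorphM hM rmorph_sum; apply: eq_bigr => i _.
    exact: spec_pi_chi.
- by move=> u v; rewrite mulrDr.
- by move=> c v; rewrite /chi_act mulrCA.
Qed.


(** The map from f to the class of f(x_i) is an algebra morphism that kills T_N - [phi] (T_N(x_i)),
    hence kills the error term of the interpolation. *)
Lemma spec_pi_horner_alg (i : 'I_3) (z : 'I_N -> R[i]) c (f : {poly R[i]}) :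
  injective z -> c != 0 ->
  tcheb N 'X - (phi (chi_gen R N i))%:P = c *: \prod_k ('X - (z k)%:P) ->
  pi (horner_alg 'X_i f) =
  \sum_k f.[z k] *: pi (horner_alg 'X_i (lagrange z k)).
Proof.
move=> z_inj c0 Tz; pose L g := pi (horner_alg 'X_i g).
suff : L f = \sum_k f.[z k] *: L (lagrange z k) by [].
have LD g g' : L (g + g') = L g + L g' by rewrite /L !rmorphD.
have LM g g' : L (g * g') = L g * L g' by rewrite /L !rmorphM.
have L0 : L 0 = 0 by rewrite /L !rmorph0.
have LZ k g : L (k *: g) = k *: L g.
  by rewrite -mul_polyC LM {1}/L /= horner_algC spec_piZ rmorph1 -scalerAl mul1r.
set P := \prod_k _ in Tz.
have LP : L P = 0.
  apply: (scalerI c0); rewrite scaler0 -LZ -Tz /L.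
  rewrite rmorphB /= horner_algC horner_alg_tcheb rmorphB /=.
  have -> : pi (tcheb N 'X_i) = phi (chi_gen R N i) *: pi 1.
    by rewrite -spec_pi_chi mulr1.
  by rewrite spec_piZ subrr.
have [q fq] := lagrange_interpolation z_inj f; rewrite -/P in fq.
clearbody L; rewrite {1}fq LD LM LP mulr0 addr0 (big_morph L LD L0).
by apply: eq_bigr => k _; rewrite LZ.
Qed.

Lemma meval_horner_alg v (i : 'I_3) (f : {poly R[i]}) :
  (horner_alg ('X_i : S) f).@[v] = f.[v i].
Proof.
elim/poly_ind: f => [|f c IH]; first by rewrite rmorph0 meval0 horner0.
rewrite rmorphD rmorphM /= horner_algX horner_algC mevalD mevalM IH mevalXU.
by rewrite mevalZ meval1 mulr1 hornerMXaddC.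
Qed.

(** * Splitting of the specialization over the common roots *)

Section Split.
Variable z : 'I_3 -> 'I_N -> R[i].
Hypothesis z_inj : forall i, injective (z i).
Hypothesis z_split : forall i, exists2 c, c != 0 &
  tcheb N 'X - (phi (chi_gen R N i))%:P = c *: \prod_k ('X - (z i k)%:P).

(* The common roots of the ideal of [phi]. *)
Definition point (h : I) (i : 'I_3) : R[i] := z i (h i).

(** A polynomial representative; it is its class in [spec] that is idempotent. *)
Definition idem (h : I) : S := \prod_i horner_alg 'X_i (lagrange (z i) (h i)).

Lemma meval_idem h l : (idem h).@[point l] = (l == h)%:R.
Proof.
rewrite /idem rmorph_prod /=; under eq_bigr do rewrite meval_horner_alg lagrangeE //.
have [->|/eqP lh] := eqVneq l h; first by rewrite big1 // => i _; rewrite eqxx.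
have [i lhi] : exists i, l i != h i.
  apply/existsP; rewrite -negb_forall; apply/negP => /forallP e.
  by apply: lh; apply/ffunP => i; apply/eqP.
by rewrite (bigD1 i) //= (negPf lhi) mul0r.
Qed.

(** Each power of a variable is interpolated separately; the product over the three variables then
    distributes into a sum over the points. *)
Lemma spec_pi_idem a : pi a = \sum_h a.@[point h] *: pi (idem h).
Proof.
have mono m : pi 'X_[m] = \sum_h ('X_[m] : S).@[point h] *: pi (idem h).
  rewrite [in LHS]mpolyXE_id rmorph_prod /=.
  have powE i : pi ('X_i ^+ m i) =
      \sum_k z i k ^+ m i *: pi (horner_alg 'X_i (lagrange (z i) k)).
    have [c c0 zc] := z_split i.
    have XE : horner_alg ('X_i : S) 'X^(m i) = 'X_i ^+ m i.
      by rewrite rmorphXn /= horner_algX.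
    have := spec_pi_horner_alg 'X^(m i) (@z_inj i) c0 zc.
    rewrite XE => ->.
    by apply: eq_bigr => k _; rewrite hornerXn.
  under eq_bigr do rewrite powE.
  rewrite bigA_distr_bigA; apply: eq_bigr => h _.
  by rewrite scaler_prod mevalX /idem rmorph_prod.
rewrite {1}[a]mpolyE rmorph_sum /=.
under eq_bigr do rewrite spec_piZ mono scaler_sumr.
rewrite exchange_big; apply: eq_bigr => h _.
rewrite mevalE scaler_suml; apply: eq_bigr => m _.
by rewrite scalerA mevalX.
Qed.

Lemma meval_point_chi h (c : chi R N) : (chi_val c).@[point h] = phi c.
Proof.
have [v hv] := place_point phi; rewrite hv.
have /asboolP[p /= ->] := valP c; rewrite /threading !comp_mpoly_meval.
apply: meval_eq => i; rewrite !tnth_mktuple (tcheb_morph (meval v)) /=.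
rewrite (tcheb_morph (meval (point h))) /= !mevalXU.
(* T_N takes this value at v_i because [phi] is evaluation at v, and at the coordinate of [point h]
   because that is a root of T_N - [phi] (T_N(x_i)). *)
transitivity (phi (chi_gen R N i)); last first.
  by rewrite hv /= (tcheb_morph (meval v)) /= mevalXU.
have [d _ zd] := z_split i; apply/eqP; rewrite -subr_eq0.
have := congr1 (horner_eval (point h i)) zd.
rewrite rmorphB /= (tcheb_morph (horner_eval (point h i))) /= /horner_eval.
rewrite hornerX hornerC => ->.
by rewrite hornerZ horner_prod (bigD1 (h i)) //= hornerXsubC subrr mul0r mulr0.
Qed.

Lemma meval_point_ideal h a : pi a = 0 -> a.@[point h] = 0.
Proof.
move=> /spec_pi_eq0/asboolP[s s0 ->]; rewrite rmorph_sum big_seq big1 // => u us.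
by rewrite rmorphM /= meval_point_chi s0 // mul0r.
Qed.

(** Evaluation at a point kills the ideal, so it is defined on the quotient and reads off the
    coefficient of one idempotent. *)
Lemma idem_basis : fin_basis ( *:%R : R[i] -> spec phi -> spec phi)
  (fun h => pi (idem h)).
Proof.
split=> [u | d sum0 h].
  have [a ->] := spec_pi_surj u; exists (fun h => a.@[point h]).
  exact: spec_pi_idem.
have /(meval_point_ideal h) : pi (\sum_l d l *: idem l) = 0.
  by rewrite rmorph_sum -[RHS]sum0; apply: eq_bigr => k _; rewrite /= spec_piZ.
rewrite rmorph_sum /=.
under eq_bigr do rewrite mevalZ meval_idem.
rewrite (bigD1 h) //= eqxx mulr1 big1 ?addr0 // => l.
by rewrite eq_sym => /negPf ->; rewrite mulr0.
Qed.

Lemma spec_trace_points a : spec_trace (pi a) = \sum_h a.@[point h].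
Proof.
rewrite /spec_trace (fin_basis_trace (scale_action _) idem_basis
  (M := fun i j => (a * idem j).@[point i])).
- by apply: eq_bigr => h _; rewrite mevalM meval_idem eqxx mulr1.
- by move=> u v; rewrite mulrDr.
- by move=> c v; rewrite -scalerAr.
- by move=> h; rewrite -rmorphM -spec_pi_idem.
Qed.

Lemma spec_trace1 : spec_trace (1 : spec phi) = (N ^ 3)%:R.
Proof.
rewrite -(rmorph1 (spec_pi phi)) spec_trace_points.
under eq_bigr do rewrite meval1.
by rewrite sumr_const card_ffun !card_ord.
Qed.

Lemma Tr_spec_pi a : Tr_spec (pi a) = phi (Tr N a).
Proof.
by rewrite /Tr_spec spec_trace1 spec_trace_pi /Tr linearZ /= mulrC.
Qed.

Lemma Tr_spec_scalar : scalar (@Tr_spec R N phi).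
Proof.
move=> k u v; have [a ->] := spec_pi_surj u; have [b ->] := spec_pi_surj v.
rewrite -spec_piZ -rmorphD /Tr_spec /= !spec_trace_points mulrA -mulrDl.
congr (_ / _); rewrite mulr_sumr -big_split; apply: eq_bigr => h _.
by rewrite mevalD mevalZ.
Qed.

(** Pairing with the idempotent at a point isolates the value there, and these values determine
    [u]. *)
Lemma Tr_spec_nondegenerate (u : spec phi) : (forall v, Tr_spec (u * v) = 0) -> u = 0.
Proof.
have [a ->] := spec_pi_surj u => a0; rewrite spec_pi_idem big1 // => h _.
have /eqP := a0 (pi (idem h)).
rewrite -rmorphM /Tr_spec spec_trace1 spec_trace_points (bigD1 h) //= big1.
  rewrite addr0 mevalM meval_idem eqxx mulr1 mulf_eq0 invr_eq0 pnatr_eq0.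
  by rewrite expn_eq0 -leqn0 leqNgt N_gt0 orbF => /eqP ->; rewrite scale0r.
by move=> l lh; rewrite mevalM meval_idem (negPf lh) mulr0.
Qed.

End Split.

Lemma spec_nondegenerate :
  (forall i : 'I_3, phi (chi_gen R N i) != 2 /\ phi (chi_gen R N i) != - 2) ->
  (exists s : spec phi -> spec phi -> R[i],
     [/\ specializes_sigma s, forall u v, s u v = Tr_spec (u * v)
       & nondegenerate_form s])
  /\ frobenius_algebra (@Tr_spec R N phi).
Proof.
move=> phi2; have /choice[z zP] := fun i =>
  @tcheb_split R[i] N (phi (chi_gen R N i)) N_gt0 (phi2 i).1 (phi2 i).2.
have z_inj i := (zP i).1; have z_split i := (zP i).2.
have nondeg := Tr_spec_nondegenerate z_inj z_split.
split.
  exists (fun u v => Tr_spec (u * v)); split=> //.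
    by move=> a b; rewrite -rmorphM /= (Tr_spec_pi z_inj z_split).
  by split=> // v v0; apply: nondeg => u; rewrite mulrC.
split=> //; last exact: (Tr_spec_scalar z_inj z_split).
by do 2!eexists; exact: (fin_basisP (scale_action _) spec_fin_basis).
Qed.

End Spec.

Theorem proposition4p4 (R : realType) (N : nat) (N_ge3 : (3 <= N)%N)
    (N_odd : odd N) :
  (forall (G : groupType) (a b : G), free_on_two a b ->
     character_variety_is_affine_space R G 3)
  /\
  (forall phi : place R N,
     (forall i : 'I_3, phi (chi_gen R N i) != 2 /\ phi (chi_gen R N i) != - 2) ->
     (exists s : spec phi -> spec phi -> R[i],
        [/\ specializes_sigma s,
            forall u v, s u v = Tr_spec (u * v)
          & nondegenerate_form s])
     /\ frobenius_algebra (@Tr_spec R N phi)).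
Proof.
split=> [G a b | phi]; first exact: character_variety_free2.
by apply: spec_nondegenerate; exact: leq_trans N_ge3.
Qed.
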